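(* Let $s\ge 1$ be an integer and let $\lambda,\mu,\nu\in\mathbb{C}$ be such that $\frac{2^\mu t^\nu}{\lambda e^t+1}$ has a power series expansion in $t$ at $t=0$. Then for each pair of positive integers $c,d$, all integers $n\ge 0$, all $m\in\mathbb{N}=\{1,2,\dots\}$ and all $x,y,X,Y\in\mathbb{C}$, the Gould-Hopper Apostol type polynomials satisfy $$\sum_{k=0}^n\binom{n}{k}\sum_{i=0}^{c-1}\sum_{j=0}^{d-1}(-1)^{i+j}\lambda^{i+j}c^k d^{n-k}\,{}_{H^{(s)}}\mathcal{F}_k^{(m)}\Big(dx+\frac{d}{c}i,d^{s}y;\lambda;\mu,\nu\Big)\,{}_{H^{(s)}}\mathcal{F}_{n-k}^{(m)}\Big(cX+\frac{c}{d}j,c^{s}Y;\lambda;\mu,\nu\Big)$$ $$=\sum_{k=0}^n\binom{n}{k}\sum_{i=0}^{d-1}\sum_{j=0}^{c-1}(-1)^{i+j}\lambda^{i+j}d^k c^{n-k}\,{}_{H^{(s)}}\mathcal{F}_k^{(m)}\Big(cx+\frac{c}{d}i,c^{s}y;\lambda;\mu,\nu\Big)\,{}_{H^{(s)}}\mathcal{F}_{n-k}^{(m)}\Big(dX+\frac{d}{c}j,d^{s}Y;\lambda;\mu,\nu\Big).$$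
   Context: For an integer $m\ge 0$, the Gould-Hopper Apostol type polynomials ${}_{H^{(s)}}\mathcal{F}_n^{(m)}(x,y;\lambda;\mu,\nu)$ of order $m$ are defined by the generating function (an identity of power series in $t$) $$\Big(\frac{2^\mu t^\nu}{\lambda e^{t}+1}\Big)^m e^{xt+yt^s}=\sum_{n=0}^{\infty}{}_{H^{(s)}}\mathcal{F}_n^{(m)}(x,y;\lambda;\mu,\nu)\frac{t^{n}}{n!}.$$ The base factor has a power series expansion exactly when $\nu$ is a nonnegative integer and, in the case $\lambda=-1$, $\nu\ge 1$. Here $2^\mu=e^{\mu\log 2}$, and $\lambda^0=1$. *)

(* Defs.v *)
From mathcomp Require Import all_boot all_order all_algebra.
From mathcomp Require Import all_classical all_reals all_analysis.
From mathcomp Require Import complex.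

Set Implicit Arguments.
Unset Strict Implicit.
Unset Printing Implicit Defensive.

Import Order.TTheory GRing.Theory Num.Theory.
Import numFieldNormedType.Exports.

Local Open Scope classical_set_scope.
Local Open Scope complex_scope.
Local Open Scope ring_scope.

(* The complex numbers are R[i] for R : realType. *)

Section ComplexPowers.
Variable R : realType.
Implicit Types z a : R[i].

Definition cexp z : R[i] :=
  (expR (complex.Re z))%:C * (cos (complex.Im z) +i* sin (complex.Im z)).

(* Principal argument, in ]-pi, pi]; only meaningful for z != 0. *)
Definition carg z : R :=
  let theta := acos (complex.Re z / Normc.normc z) in
  if 0 <= complex.Im z then theta else - theta.

Definition clog z : R[i] := ln (Normc.normc z) +i* carg z.

(* Principal value; only meaningful for z != 0. *)
Definition cpow z a : R[i] := cexp (a * clog z).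

End ComplexPowers.

(* A formal power series \sum_n f_n t^n is its coefficient sequence f. *)
Section FormalPowerSeries.
Variable K : fieldType.
Implicit Types f g : nat -> K.

Definition fps_one : nat -> K := fun n => (n == 0%N)%:R.

Definition fps_mul f g : nat -> K :=
  fun n => \sum_(k < n.+1) f k * g (n - k)%N.

Definition fps_pow f (m : nat) : nat -> K := iter m (fps_mul f) fps_one.

(* \sum_k f^k / k!, for f with f 0 = 0: then f^k has no term of degree less
   than k, so that only k <= n contributes to the coefficient of t^n. *)
Definition fps_exp f : nat -> K :=
  fun n => \sum_(k < n.+1) fps_pow f k n / k`!%:R.

End FormalPowerSeries.

Section GouldHopperApostol.
Variable R : realType.
Implicit Types lambda mu nu x y t : R[i].

Definition base_factor lambda mu nu t : R[i] :=
  cexp (mu * (ln 2)%:C) * cpow t nu / (lambda * cexp t + 1).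

(* The neighbourhood of 0 is punctured: at t = 0 the factor is undefined or a
   removable singularity. R[i]^o carries the topology of the modulus. *)
Definition is_base_expansion lambda mu nu (a : nat -> R[i]) : Prop :=
  \forall t \near (0 : R[i]^o)^',
    [series a k * t ^+ k]_k @ \oo --> (base_factor lambda mu nu t : R[i]^o).

Definition has_base_expansion lambda mu nu : Prop :=
  exists a : nat -> R[i], is_base_expansion lambda mu nu a.

(* The coefficients of the expansion, unique when it exists. *)
Definition base_coef lambda mu nu : nat -> R[i] :=
  xget (fun=> 0) [set a | is_base_expansion lambda mu nu a].

(* n! times the coefficient of t^n in
   (2^mu t^nu / (lambda e^t + 1))^m e^(x t + y t^s), for s >= 1. *)
Definition GHApoly (s m n : nat) x y lambda mu nu : R[i] :=
  n`!%:R *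
  fps_mul (fps_pow (base_coef lambda mu nu) m)
    (fps_exp (fun k => x * (k == 1%N)%:R + y * (k == s)%:R)) n.

End GouldHopperApostol.

(* Main.v *)
(* Both sides are n! times the t^n-coefficient of one power series: with A the
   expansion of the base factor, the (i, j) summand on the left has exponential
   generating function
     (-lambda)^(i + j) A(ct)^m A(dt)^m
       exp((cd(x + X) + di + cj) t + (cd)^s (y + Y) t^s),
   and the (j, i) summand on the right has the same one. The identity is thus
   formal and holds for any coefficient sequence A. *)
Require Import Defs.
From mathcomp Require Import all_boot all_order all_algebra.
From mathcomp Require Import all_classical all_reals all_analysis.
From mathcomp Require Import complex ring.

Set Implicit Arguments.
Unset Strict Implicit.
Unset Printing Implicit Defensive.

Import GRing.Theory Num.Theory.

Local Open Scope ring_scope.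

Section FpsRing.
Variable K : fieldType.
Implicit Types f g h : nat -> K.

(** The coefficient of degree [n] only sees terms of degree at most [n], so truncation below [N]
    loses nothing. This transfers the ring laws of [{poly K}] to series. *)
Lemma fps_mul_coefM N f g n : (n < N)%N ->
  fps_mul f g n = ((\poly_(i < N) f i) * (\poly_(i < N) g i))`_n.
Proof.
move=> nN; rewrite coefM; apply: eq_bigr => k _; rewrite !coef_poly.
by rewrite (leq_trans (ltn_ord k) nN) (leq_ltn_trans (leq_subr _ _) nN).
Qed.

Lemma eq_coef_mul (p p' q q' : {poly K}) N :
  (forall i, (i < N)%N -> p`_i = p'`_i) ->
  (forall i, (i < N)%N -> q`_i = q'`_i) ->
  forall i, (i < N)%N -> (p * q)`_i = (p' * q')`_i.
Proof.
move=> pp' qq' i iN; rewrite !coefM; apply: eq_bigr => k _.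
by rewrite pp' ?qq' ?(leq_ltn_trans (leq_subr _ _) iN) ?(leq_trans (ltn_ord k)).
Qed.

Lemma fps_mulC : commutative (@fps_mul K).
Proof.
by move=> f g; apply: funext => n; rewrite !(@fps_mul_coefM n.+1) // mulrC.
Qed.

Lemma fps_mulA : associative (@fps_mul K).
Proof.
move=> f g h; apply: funext => n; rewrite !(@fps_mul_coefM n.+1) //.
transitivity ((\poly_(i < n.+1) f i * \poly_(i < n.+1) g i
  * \poly_(i < n.+1) h i)`_n); first rewrite -mulrA.
all: apply: (@eq_coef_mul _ _ _ _ n.+1) => // i iN.
all: by rewrite coef_poly iN (@fps_mul_coefM n.+1).
Qed.

Lemma fps_mulACA : interchange (@fps_mul K) (@fps_mul K).
Proof.
by move=> f g h k; rewrite -!fps_mulA (fps_mulA g) (fps_mulC g) -(fps_mulA h).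
Qed.

Lemma fps_pow_coef N f m n : (n < N)%N ->
  fps_pow f m n = ((\poly_(i < N) f i) ^+ m)`_n.
Proof.
elim: m n => [|m IH] n nN; first by rewrite expr0 coef1.
rewrite [LHS](@fps_mul_coefM N) // exprS.
apply: (@eq_coef_mul _ _ _ _ N) => // i iN.
by rewrite coef_poly iN; apply: IH.
Qed.

(** The substitution of a t for t. *)
Definition fps_scale (a : K) f : nat -> K := fun n => a ^+ n * f n.

Lemma fps_scaleM a f g :
  fps_scale a (fps_mul f g) = fps_mul (fps_scale a f) (fps_scale a g).
Proof.
apply: funext => n; rewrite /fps_scale /fps_mul mulr_sumr.
apply: eq_bigr => k _; rewrite mulrACA -exprD subnKC //.
by rewrite -ltnS.
Qed.

Lemma fps_scaleX a f m :
  fps_scale a (fps_pow f m) = fps_pow (fps_scale a f) m.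
Proof.
elim: m => [|m IH]; last by rewrite [RHS]/= -/(fps_pow _ m) -IH -fps_scaleM.
by apply: funext => -[|n]; rewrite /fps_scale /= /fps_one ?expr0 ?mul1r ?mulr0.
Qed.

Lemma fps_scale_exp a f : fps_scale a (fps_exp f) = fps_exp (fps_scale a f).
Proof.
apply: funext => n; rewrite /fps_scale /fps_exp mulr_sumr.
by apply: eq_bigr => k _; rewrite mulrA -fps_scaleX.
Qed.

(** Both [p] and [q] are multiples of ['X], so the product is a multiple of ['X^(i + j)]. *)
Lemma coef_expM_small (p q : {poly K}) i j n : p`_0 = 0 -> q`_0 = 0 ->
  (n < i + j)%N -> (p ^+ i * q ^+ j)`_n = 0.
Proof.
have dvdX (r : {poly K}) : r`_0 = 0 -> exists r', r = 'X * r'.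
  move=> r0; have /factor_theorem[r' ->] : root r 0 by rewrite /root horner_coef0 r0.
  by exists r'; rewrite subr0 mulrC.
move=> /dvdX[p' ->] /dvdX[q' ->] nij.
by rewrite !exprMn mulrACA -exprD mulrC coefMXn nij.
Qed.

(** As [f] has no constant term, its powers of exponent above [n] vanish in degree [n]. Hence a
    single cut-off [N] serves all degrees below [N], and the exponential can be handled as one
    polynomial. *)
Lemma fps_exp_coef N f n : f 0%N = 0 -> (n < N)%N ->
  fps_exp f n = (\sum_(k < N) k`!%:R^-1 *: (\poly_(i < N) f i) ^+ k)`_n.
Proof.
move=> f0 nN; set p := \poly_(_ < _) _.
have p0 : p`_0 = 0 by rewrite coef_poly f0 if_same.
rewrite coef_sum (bigID (fun k : 'I_N => (k < n.+1)%N)) /= [X in _ + X]big1 ?addr0.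
  rewrite -(big_ord_widen N (fun k => (k`!%:R^-1 *: p ^+ k)`_n)) //.
  by apply: eq_bigr => k _; rewrite coefZ (@fps_pow_coef N) // mulrC.
move=> k; rewrite -leqNgt => nk; rewrite coefZ.
by rewrite -(mulr1 (p ^+ k)) -(expr0 p) coef_expM_small ?mulr0 ?addn0.
Qed.

End FpsRing.

Lemma sum_antidiagonal (V : nmodType) N (F : nat -> nat -> V) :
  \sum_(k < N) \sum_(i < k.+1) F i (k - i)%N =
  \sum_(i < N) \sum_(j < N - i) F i j.
Proof.
under eq_bigr => k _ do rewrite (big_ord_widen N (fun i => F i (k - i)%N)) //.
rewrite (exchange_big_dep predT) //=; apply: eq_bigr => i _.
(* For fixed [i] the index [k] runs over [i <= k < N]; the shift [k = j + i] follows. *)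
rewrite -(big_geq_mkord i N predT (fun k => F i (k - i)%N)).
rewrite -{1}(add0n (nat_of_ord i)) big_addn big_mkord.
by apply: eq_bigr => j _; rewrite addnK.
Qed.

(** The binomial theorem for the truncations [p] and [q], after division by [k!], which is nonzero
    in characteristic 0. *)
Lemma fps_expD (K : numFieldType) (f g : nat -> K) : f 0%N = 0 -> g 0%N = 0 ->
  fps_exp (fun n => f n + g n) = fps_mul (fps_exp f) (fps_exp g).
Proof.
move=> f0 g0; apply: funext => n.
rewrite (@fps_exp_coef _ n.+1) ?f0 ?g0 ?addr0 // (@fps_mul_coefM _ n.+1) //.
set p := \poly_(i < n.+1) f i; set q := \poly_(i < n.+1) g i.
pose F i j := (i`!%:R^-1 *: p ^+ i) * (j`!%:R^-1 *: q ^+ j).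
have p0 : p`_0 = 0 by rewrite coef_poly.
have q0 : q`_0 = 0 by rewrite coef_poly.
(* The product of the two truncated exponentials is a sum over a full square of indices. *)
transitivity ((\sum_(i < n.+1) \sum_(j < n.+1) F i j)`_n); last first.
  rewrite -big_distrlr /=.
  apply: (@eq_coef_mul _ _ _ _ _ n.+1) => // i iN.
  - by rewrite coef_poly iN (@fps_exp_coef _ n.+1).
  - by rewrite coef_poly iN (@fps_exp_coef _ n.+1).
(* Terms with [i + j > n] do not reach degree [n], so only the triangle [i + j <= n] remains; its
   antidiagonals are the powers of [p + q]. *)
transitivity ((\sum_(i < n.+1) \sum_(j < n.+1 - i) F i j)`_n); last first.
  rewrite !coef_sum; apply: eq_bigr => i _.
  rewrite (big_ord_widen n.+1) ?leq_subr // !coef_sum big_mkcond /=.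
  apply: eq_bigr => j _; case: ltnP => // nij.
  rewrite /F -scalerAl -scalerAr !coefZ coef_expM_small ?mulr0 //.
  by rewrite -leq_subLR.
rewrite -sum_antidiagonal; congr ((_ : {poly K})`_n); apply: eq_bigr => k _.
(* In this order of summands [exprDn] gives [p] the exponent [i], as in [F i (k - i)]. *)
have -> : \poly_(i < n.+1) (f i + g i) = q + p.
  by apply/polyP => i; rewrite coefD !coef_poly addrC; case: ifP; rewrite ?addr0.
rewrite exprDn scaler_sumr; apply: eq_bigr => i _.
rewrite /F -scalerAl -scalerAr scalerA mulrC -scaler_nat scalerA; congr (_ *: _).
rewrite -(@bin_fact k i) -1?ltnS // !natrM.
have nz j : j`!%:R != 0 :> K by rewrite pnatr_eq0 -lt0n fact_gt0.
by field; rewrite !nz pnatr_eq0 -lt0n bin_gt0 -ltnS ltn_ord.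
Qed.

Section SymmetricConvolution.
Variables (K : numFieldType) (s m : nat) (A : nat -> K).
Hypothesis s_gt0 : (0 < s)%N.

Let gen (x y : K) (k : nat) := x * (k == 1%N)%:R + y * (k == s)%:R.

(** [GHApoly] with the expansion of the base factor replaced by an arbitrary sequence [A]. *)
Definition gould_hopper (x y : K) (n : nat) : K :=
  n`!%:R * fps_mul (fps_pow A m) (fps_exp (gen x y)) n.

Lemma gen0 a b : gen a b 0 = 0.
Proof. by rewrite /gen (ltn_eqF s_gt0) !mulr0 addr0. Qed.

Lemma fps_scale_gen c a b : fps_scale c (gen a b) = gen (c * a) (c ^+ s * b).
Proof.
apply: funext => k; rewrite /fps_scale /gen mulrDr !mulrA.
by congr (_ + _); case: eqP => [->|_]; rewrite ?mulr0 ?expr1.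
Qed.

(** A binomial convolution is a product of exponential generating functions, taken here at c t and d
    t. The two exponentials merge, so the arguments enter only through [c * a + d * a'] and
    [c ^+ s * b + d ^+ s * b']. *)
Lemma gould_hopper_convolution n (c d a b a' b' : K) :
  \sum_(k < n.+1) 'C(n, k)%:R *
    (c ^+ k * d ^+ (n - k) * gould_hopper a b k * gould_hopper a' b' (n - k)) =
  n`!%:R * fps_mul
    (fps_mul (fps_pow (fps_scale c A) m) (fps_pow (fps_scale d A) m))
    (fps_exp (gen (c * a + d * a') (c ^+ s * b + d ^+ s * b'))) n.
Proof.
have -> : gen (c * a + d * a') (c ^+ s * b + d ^+ s * b') =
    fun k => gen (c * a) (c ^+ s * b) k + gen (d * a') (d ^+ s * b') k.
  by apply: funext => k; rewrite /gen; ring.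
rewrite fps_expD ?gen0 // fps_mulACA -!fps_scale_gen -!fps_scaleX -!fps_scale_exp.
rewrite -!fps_scaleM mulr_sumr; apply: eq_bigr => k _.
rewrite -(@bin_fact n k) -1?ltnS // !natrM /fps_scale /gould_hopper; ring.
Qed.

(** The weight does not depend on [k], so the sum over [k] can be moved innermost and evaluated as a
    convolution. *)
Lemma gould_hopper_double_sum n (c d : K) (p q : nat) (w : nat -> nat -> K)
    (a a' : nat -> K) (b b' : K) :
  \sum_(k < n.+1) 'C(n, k)%:R * \sum_(i < p) \sum_(j < q)
    (w i j * c ^+ k * d ^+ (n - k) *
     gould_hopper (a i) b k * gould_hopper (a' j) b' (n - k)) =
  \sum_(i < p) \sum_(j < q) w i j * (n`!%:R * fps_mul
    (fps_mul (fps_pow (fps_scale c A) m) (fps_pow (fps_scale d A) m))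
    (fps_exp (gen (c * a i + d * a' j) (c ^+ s * b + d ^+ s * b'))) n).
Proof.
under eq_bigr => k _ do rewrite mulr_sumr.
rewrite exchange_big; apply: eq_bigr => i _.
under eq_bigr => k _ do rewrite mulr_sumr.
rewrite exchange_big; apply: eq_bigr => j _.
rewrite -gould_hopper_convolution mulr_sumr.
by apply: eq_bigr => k _; rewrite -!(mulrA (w i j)) (mulrCA _ (w i j)) !mulrA.
Qed.

Lemma gould_hopper_symmetry n (c d : nat) (l x y X Y : K) :
  (0 < c)%N -> (0 < d)%N ->
  \sum_(k < n.+1) 'C(n, k)%:R * \sum_(i < c) \sum_(j < d)
    ((-1) ^+ (i + j) * l ^+ (i + j) * c%:R ^+ k * d%:R ^+ (n - k) *
     gould_hopper (d%:R * x + d%:R / c%:R * i%:R) (d%:R ^+ s * y) k *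
     gould_hopper (c%:R * X + c%:R / d%:R * j%:R) (c%:R ^+ s * Y) (n - k)) =
  \sum_(k < n.+1) 'C(n, k)%:R * \sum_(i < d) \sum_(j < c)
    ((-1) ^+ (i + j) * l ^+ (i + j) * d%:R ^+ k * c%:R ^+ (n - k) *
     gould_hopper (c%:R * x + c%:R / d%:R * i%:R) (c%:R ^+ s * y) k *
     gould_hopper (d%:R * X + d%:R / c%:R * j%:R) (d%:R ^+ s * Y) (n - k)).
Proof.
move=> c_gt0 d_gt0.
have c_neq0 : c%:R != 0 :> K by rewrite pnatr_eq0 -lt0n.
have d_neq0 : d%:R != 0 :> K by rewrite pnatr_eq0 -lt0n.
pose w i j : K := (-1) ^+ (i + j) * l ^+ (i + j).
rewrite [LHS](@gould_hopper_double_sum _ _ _ _ _ w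
  (fun i => d%:R * x + d%:R / c%:R * i%:R)
  (fun j => c%:R * X + c%:R / d%:R * j%:R)).
rewrite [RHS](@gould_hopper_double_sum _ _ _ _ _ w
  (fun i => c%:R * x + c%:R / d%:R * i%:R)
  (fun j => d%:R * X + d%:R / c%:R * j%:R)).
(* The [(i, j)] term on the left is matched with the [(j, i)] term on the right. *)
rewrite exchange_big; apply: eq_bigr => j _; apply: eq_bigr => i _.
have -> : w i j = w j i by rewrite /w addnC.
rewrite [fps_mul (fps_pow _ _) _]fps_mulC.
(* Both sides equal c d (x + X) + d i + c j once the denominators cancel. *)
have -> : c%:R * (d%:R * x + d%:R / c%:R * i%:R) +
    d%:R * (c%:R * X + c%:R / d%:R * j%:R) =
    d%:R * (c%:R * x + c%:R / d%:R * j%:R) +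
    c%:R * (d%:R * X + d%:R / c%:R * i%:R) :> K.
  by field; rewrite c_neq0 d_neq0.
by have -> : c%:R ^+ s * (d%:R ^+ s * y) + d%:R ^+ s * (c%:R ^+ s * Y) =
  d%:R ^+ s * (c%:R ^+ s * y) + c%:R ^+ s * (d%:R ^+ s * Y) :> K by ring.
Qed.

End SymmetricConvolution.

Theorem corollary3p2 (R : realType) (s : nat) (hs : (1 <= s)%N)
    (lambda mu nu : R[i]%C) (hexp : has_base_expansion lambda mu nu)
    (c d : nat) (hc : (0 < c)%N) (hd : (0 < d)%N)
    (n m : nat) (hm : (1 <= m)%N) (x y X Y : R[i]%C) :
  \sum_(k < n.+1) 'C(n, k)%:R *
    \sum_(i < c) \sum_(j < d)
      ((-1) ^+ (i + j) * lambda ^+ (i + j) * c%:R ^+ k * d%:R ^+ (n - k) *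
       GHApoly s m k (d%:R * x + d%:R / c%:R * i%:R) (d%:R ^+ s * y)
         lambda mu nu *
       GHApoly s m (n - k) (c%:R * X + c%:R / d%:R * j%:R) (c%:R ^+ s * Y)
         lambda mu nu)
  =
  \sum_(k < n.+1) 'C(n, k)%:R *
    \sum_(i < d) \sum_(j < c)
      ((-1) ^+ (i + j) * lambda ^+ (i + j) * d%:R ^+ k * c%:R ^+ (n - k) *
       GHApoly s m k (c%:R * x + c%:R / d%:R * i%:R) (c%:R ^+ s * y)
         lambda mu nu *
       GHApoly s m (n - k) (d%:R * X + d%:R / c%:R * j%:R) (d%:R ^+ s * Y)
         lambda mu nu).
Proof.
(* For this choice of [A], [gould_hopper] and [GHApoly] agree by unfolding. *)
exact: (@gould_hopper_symmetry _ s m (base_coef lambda mu nu)).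
Qed.
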